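(* Let $R$ be a ring, let $\mathfrak{X}$ be a class of left $R$-modules that contains all projective left $R$-modules, and let $0\to A\to B\to C\to 0$ be a short exact sequence of left $R$-modules. (1) If $A$ and $C$ have finite $\mathfrak{X}$-Gorenstein projective dimension, then so has $B$. (2) If $A$ and $B$ have finite $\mathfrak{X}$-Gorenstein projective dimension, then so has $C$. (3) If $B$ and $C$ have finite $\mathfrak{X}$-Gorenstein projective dimension, then so has $A$.
   Context: $R$ is a non-trivial associative ring with identity; all modules are unital left $R$-modules. A module $G$ is called $\mathfrak{X}$-Gorenstein projective if there is an exact sequence $\cdots\to P_1\to P_0\to P^0\to P^1\to\cdots$ of projective modules which remains exact after applying $\mathrm{Hom}_R(-,X)$ for every $X\in\mathfrak{X}$, and such that $G=\mathrm{Ker}(P_0\to P^0)$ (up to isomorphism). The $\mathfrak{X}$-Gorenstein projective dimension $\mathfrak{X}\text{-}\mathrm{Gpd}(M)$ of a module $M$ is the infimum of all integers $n\ge 0$ for which there is an exact sequence $0\to G_n\to\cdots\to G_1\to G_0\to M\to 0$ with all $G_i$ $\mathfrak{X}$-Gorenstein projective, and it is $\infty$ if there is no such $n$. *)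

(* Defs.v *)
From HB Require Import structures.
From mathcomp Require Import all_boot all_order all_algebra.
From mathcomp Require Import boolp constructive_ereal.

Set Implicit Arguments.
Unset Strict Implicit.
Unset Printing Implicit Defensive.

Import Order.TTheory GRing.Theory Num.Theory.

Local Open Scope ring_scope.

Definition surj (T U : Type) (f : T -> U) : Prop := forall y, exists x, f x = y.

Definition exact_at (R : nzRingType) (L M N : lmodType R)
    (f : {linear L -> M}) (g : {linear M -> N}) : Prop :=
  forall y : M, g y = 0 <-> exists x : L, f x = y.

Definition short_exact (R : nzRingType) (A B C : lmodType R)
    (f : {linear A -> B}) (g : {linear B -> C}) : Prop :=
  [/\ injective f, exact_at f g & surj g].

Definition projective (R : nzRingType) (P : lmodType R) : Prop :=
  forall (M N : lmodType R) (p : {linear M -> N}) (h : {linear P -> N}),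
    surj p -> exists k : {linear P -> M}, forall x, p (k x) = h x.

(* Exactness of Hom(N, X) -> Hom(M, X) -> Hom(L, X) at Hom(M, X), spelled out
   since Hom sets over a noncommutative ring are not R-modules. *)
Definition hom_exact_at (R : nzRingType) (X L M N : lmodType R)
    (f : {linear L -> M}) (g : {linear M -> N}) : Prop :=
  forall h : {linear M -> X},
    (forall x : L, h (f x) = 0) <->
    exists k : {linear N -> X}, forall y : M, k (g y) = h y.

(* A sequence ... -> P_1 -> P_0 -> P^0 -> P^1 -> ... unbounded in both
   directions: P_n is [lob n], P^n is [upb n], and [midd] is P_0 -> P^0. *)
Record biseq (R : nzRingType) := BiSeq {
  lob : nat -> lmodType R;
  upb : nat -> lmodType R;
  lod : forall n, {linear lob n.+1 -> lob n};
  midd : {linear lob 0 -> upb 0};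
  upd : forall n, {linear upb n -> upb n.+1}
}.

Definition biseq_all_terms (R : nzRingType) (Q : lmodType R -> Prop)
    (P : biseq R) : Prop :=
  forall n, Q (lob P n) /\ Q (upb P n).

Definition biseq_all_spots (R : nzRingType)
    (E : forall L M N : lmodType R,
       {linear L -> M} -> {linear M -> N} -> Prop)
    (P : biseq R) : Prop :=
  [/\ forall n, E _ _ _ (lod P n.+1) (lod P n),
      E _ _ _ (lod P 0) (midd P),
      E _ _ _ (midd P) (upd P 0)
    & forall n, E _ _ _ (upd P n) (upd P n.+1)].

(* [injective i] and [exact_at i (midd P)] say that i identifies G with
   the kernel of P_0 -> P^0. *)
Definition Xgproj (R : nzRingType) (XX : lmodType R -> Prop)
    (G : lmodType R) : Prop :=
  exists P : biseq R,
    [/\ biseq_all_terms (@projective R) P,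
        biseq_all_spots (@exact_at R) P,
        forall X : lmodType R, XX X -> biseq_all_spots (@hom_exact_at R X) P
      & exists i : {linear G -> lob P 0},
          injective i /\ exact_at i (midd P)].

(* An exact sequence 0 -> G_n -> ... -> G_1 -> G_0 -> M -> 0 of
   XX-Gorenstein projective modules, encoded as an infinite sequence
   whose terms of index > n are zero modules. *)
Definition has_Xgproj_resolution (R : nzRingType) (XX : lmodType R -> Prop)
    (M : lmodType R) (n : nat) : Prop :=
  exists (G : nat -> lmodType R) (d : forall i, {linear G i.+1 -> G i})
         (e : {linear G 0 -> M}),
    [/\ forall i, (i <= n)%N -> Xgproj XX (G i),
        forall i, (n < i)%N -> forall x : G i, x = 0,
        surj e,
        exact_at (d 0) e
      & forall i, exact_at (d i.+1) (d i)].

Definition Xgpd (R : nzRingType) (XX : lmodType R -> Prop)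
    (M : lmodType R) : \bar int :=
  match pselect (exists n : nat, `[< has_Xgproj_resolution XX M n >]) with
  | left ex_n => ((ex_minn ex_n)%:Z)%:E
  | right _ => +oo%E
  end.

(* Main.v *)
Require Import Defs.
From HB Require Import structures.
From mathcomp Require Import all_boot all_order all_algebra.
From mathcomp Require Import boolp constructive_ereal.

(** Gorenstein projectivity relative to [XX] is first freed from unbounded
    complexes.  Cutting a complete resolution at all its cycles shows that a
    module is [XX]-Gorenstein projective exactly when it lies in some class W
    of modules such that every M in W satisfies Ext^1(M, X) = 0 for all X in
    [XX] and sits in short exact sequences 0 -> K -> P -> M -> 0 and
    0 -> M -> P' -> N -> 0 with P, P' projective and K, N in W
    ([Xgproj_gproj], [gproj_Xgproj]).  The union [gproj] of these classes is
    again such a class, so membership is proved coinductively ([gproj_coind]).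

    From this the class of Gorenstein projectives is closed under extensions
    ([gproj_extension]): the two horseshoe lemmas put an extension of such
    modules between projectives, with an extension of such modules left over
    on either side.  The right-hand horseshoe needs a map A -> P into a
    projective to extend along A -> B, that is Ext^1(C, P) = 0; this is where
    [XX] has to contain the projectives.  The class is also closed under
    kernels of epimorphisms B -> C ([gproj_kernel]): pulling B back along an
    epimorphism P -> C with P projective and Gorenstein projective kernel C'
    gives an extension T of B by C' with T / A = P, so that A is a direct
    summand of T with projective complement, and this case is treated directly
    ([gproj_summand]).

    Having finite dimension is then the inductive closure [finite_gdim] of
    Gorenstein projectivity under 0 -> K -> G -> M -> 0 with G Gorenstein
    projective and K of finite dimension, and the three claims follow by
    replacing one term at a time.
    - Extensions.  Suppose first that C is Gorenstein projective, and induct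
      on A, given by 0 -> K -> G -> A -> 0: the horseshoe with a projective
      P -> C with kernel C' presents B as a quotient of G (+) P by an
      extension of C' by K.  In general, for C given by 0 -> K -> G -> C -> 0,
      the pullback T of B and G over C is an extension of G by A, hence
      settled, and B = T / K is handled as in the next item, where only
      extensions of K, the subject of the induction hypothesis, occur.
    - Quotients.  If B = G / K, then C = G / L where L is an extension of A
      by K.
    - Kernels.  If C is Gorenstein projective and B = G / K, then A = L / K
      where L is the kernel of G -> C, Gorenstein projective by the above.
      Otherwise C = G / K, and with T the pullback of B and G over C, the
      module A is the kernel of T -> G while T is an extension of B by K. *)

Set Implicit Arguments.
Unset Strict Implicit.
Unset Printing Implicit Defensive.

Import Order.TTheory GRing.Theory Num.Theory.
Local Open Scope ring_scope.

(** * Kernels, cokernels and factorizations of linear maps *)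

Lemma linear_of_fun (R : nzRingType) (M N : lmodType R) (f : M -> N) :
  linear f -> exists g : {linear M -> N}, g =1 f.
Proof.
move=> f_lin.
pose fL : {linear M -> N} :=
  HB.pack f (GRing.isLinear.Build R M N *:%R f f_lin).
by exists fL.
Qed.

Section KernelModule.
Variables (R : nzRingType) (M N : lmodType R) (g : {linear M -> N}).

Definition in_kernel : {pred M} := fun x => g x == 0.

Lemma in_kernel_closed : submod_closed in_kernel.
Proof.
split=> [|a x y]; first by rewrite unfold_in linear0.
rewrite !unfold_in => /eqP gx0 /eqP gy0.
by rewrite linearP gx0 gy0 scaler0 addr0.
Qed.

HB.instance Definition _ :=
  GRing.isSubmodClosed.Build R M in_kernel in_kernel_closed.

Record kernel := Kernel { kernel_val : M; _ : kernel_val \in in_kernel }.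

HB.instance Definition _ := [isSub for kernel_val].
HB.instance Definition _ := [Choice of kernel by <:].
HB.instance Definition _ := [SubChoice_isSubLmodule of kernel by <:].

End KernelModule.

Section CokernelModule.
Variables (R : nzRingType) (L M : lmodType R) (f : {linear L -> M}).

Definition in_image : {pred M} := fun y => `[< exists x, f x = y >].

Lemma in_imageP y : reflect (exists x, f x = y) (y \in in_image).
Proof. exact: asboolP. Qed.

Lemma in_image_closed : submod_closed in_image.
Proof.
split=> [|a _ _ /in_imageP[x <-] /in_imageP[y <-]]; apply/in_imageP.
  by exists 0; rewrite linear0.
by exists (a *: x + y); rewrite linearP.
Qed.

HB.instance Definition _ :=
  GRing.isSubmodClosed.Build R M in_image in_image_closed.

(** The quotient by the image as an additive group; the scaling by [R] is added
    below, acting on representatives. *)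
Definition cokernel := Quotient.quot in_image.

HB.instance Definition _ := GRing.Zmodule.on cokernel.
Local Open Scope quotient_scope.

Lemma cokernel_pi_eq x y :
  \pi_cokernel x = \pi_cokernel y <-> exists z, f z = x - y.
Proof.
split=> [pxy | /in_imageP]; last by rewrite Quotient.idealrBE => /eqP.
by apply/in_imageP; rewrite Quotient.idealrBE; apply/eqP.
Qed.

Lemma cokernel_repr q : exists x, q = \pi_cokernel x.
Proof. by exists (repr q); rewrite reprK. Qed.

Definition cokernel_scale (a : R) (q : cokernel) : cokernel :=
  \pi_cokernel (a *: repr q).

Lemma cokernel_scale_pi a x :
  cokernel_scale a (\pi_cokernel x) = \pi_cokernel (a *: x).
Proof.
apply/cokernel_pi_eq.
have /cokernel_pi_eq[z fz] :
    \pi_cokernel (repr (\pi_cokernel x)) = \pi_cokernel x.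
  by rewrite reprK.
by exists (a *: z); rewrite linearZ_LR fz scalerBr.
Qed.

Lemma cokernel_piD x y :
  \pi_cokernel (x + y) = \pi_cokernel x + \pi_cokernel y.
Proof. exact: raddfD. Qed.

Fact cokernel_scalerA a b q :
  cokernel_scale a (cokernel_scale b q) = cokernel_scale (a * b) q.
Proof.
by have [x ->] := cokernel_repr q; rewrite !cokernel_scale_pi scalerA.
Qed.

Fact cokernel_scale1r : left_id 1 cokernel_scale.
Proof.
by move=> q; have [x ->] := cokernel_repr q; rewrite cokernel_scale_pi scale1r.
Qed.

Fact cokernel_scalerDr : right_distributive cokernel_scale +%R.
Proof.
move=> a p q.
have [[x ->] [y ->]] := (cokernel_repr p, cokernel_repr q).
by rewrite -cokernel_piD !cokernel_scale_pi scalerDr cokernel_piD.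
Qed.

Fact cokernel_scalerDl q : {morph cokernel_scale^~ q : a b / a + b}.
Proof.
have [x ->] := cokernel_repr q => a b.
by rewrite !cokernel_scale_pi scalerDl cokernel_piD.
Qed.

HB.instance Definition _ := GRing.Zmodule_isLmodule.Build R cokernel
  cokernel_scalerA cokernel_scale1r cokernel_scalerDr cokernel_scalerDl.

End CokernelModule.

Lemma ex_kernel (R : nzRingType) (M N : lmodType R) (g : {linear M -> N}) :
  exists (K : lmodType R) (k : {linear K -> M}), injective k /\ exact_at k g.
Proof.
have [|k kE] := @linear_of_fun _ (kernel g) M (@kernel_val _ _ _ g) _.
  by move=> a x y.
exists (kernel g), k; split=> [x y|y].
  by rewrite !kE; exact: val_inj.
split=> [/eqP gy0|[x <-]]; last by rewrite kE; apply/eqP; exact: (valP x).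
by exists (Kernel gy0); rewrite kE.
Qed.

Lemma ex_cokernel (R : nzRingType) (L M : lmodType R) (f : {linear L -> M}) :
  exists (Q : lmodType R) (q : {linear M -> Q}), surj q /\ exact_at f q.
Proof.
have [|q qE] := @linear_of_fun _ M (cokernel f) (\pi_(cokernel f))%qT _.
  move=> a x y; rewrite cokernel_piD; congr (_ + _).
  exact/esym/cokernel_scale_pi.
exists (cokernel f), q; split=> [y|y].
  by have [x ->] := cokernel_repr y; exists x; rewrite qE.
rewrite qE -[X in X <-> _]/(_ = 0).
have -> : 0 = (\pi_(cokernel f) 0)%qT by rewrite -qE linear0.
by rewrite cokernel_pi_eq subr0.
Qed.

(** A linear map out of [M] that kills [ker p] factors through the surjection
    [p]; the factor is computed on a set-theoretic section of [p]. *)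
Lemma ex_desc (R : nzRingType) (M N X : lmodType R)
    (p : {linear M -> N}) (h : {linear M -> X}) :
  surj p -> (forall x, p x = 0 -> h x = 0) ->
  exists k : {linear N -> X}, forall x, k (p x) = h x.
Proof.
move=> p_surj ker_ph; have [s ps] := choice p_surj.
have hE x y : p x = p y -> h x = h y.
  move=> pxy; apply/eqP; rewrite -subr_eq0 -linearB; apply/eqP/ker_ph.
  by rewrite linearB pxy subrr.
have [|k kE] := @linear_of_fun _ N X (h \o s).
  by move=> a x y /=; rewrite -linearP; apply: hE; rewrite linearP !ps.
by exists k => x; rewrite kE; apply: hE; rewrite ps.
Qed.

(** Dual of [ex_desc]: the pointwise preimages under an injection are unique,
    hence automatically linear in the argument. *)
Lemma ex_lift (R : nzRingType) (L M N : lmodType R)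
    (i : {linear L -> M}) (h : {linear N -> M}) :
  injective i -> (forall x, exists y, i y = h x) ->
  exists k : {linear N -> L}, forall x, i (k x) = h x.
Proof.
move=> i_inj /choice[s si].
have [|k kE] := @linear_of_fun _ N L s.
  by move=> a x y; apply: i_inj; rewrite linearP !si linearP.
by exists k => x; rewrite kE si.
Qed.

(** * Short exact sequences and vanishing of Ext^1 *)

Section Sequences.
Variable R : nzRingType.
Implicit Types A B C K L M N P Q T X : lmodType R.

Lemma ex_pair M N1 N2 (f : {linear M -> N1}) (g : {linear M -> N2}) :
  exists k : {linear M -> (N1 * N2)%type}, forall x, k x = (f x, g x).
Proof.
have [|k kE] := @linear_of_fun _ M (N1 * N2)%type (fun x => (f x, g x)).
  by move=> a x y; rewrite !linearP.
by exists k.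
Qed.

Lemma ex_copair M1 M2 N (f : {linear M1 -> N}) (g : {linear M2 -> N}) :
  exists k : {linear (M1 * M2)%type -> N}, forall x y, k (x, y) = f x + g y.
Proof.
have [|k kE] := @linear_of_fun _ (M1 * M2)%type N (fun z => f z.1 + g z.2).
  by move=> a [x1 x2] [y1 y2] /=; rewrite !linearP scalerDr addrACA.
by exists k.
Qed.

Lemma exact_at_comp0 L M N (f : {linear L -> M}) (g : {linear M -> N}) x :
  exact_at f g -> g (f x) = 0.
Proof. by move=> fg; apply/fg; exists x. Qed.

Lemma linear_inj M N (f : {linear M -> N}) :
  (forall x, f x = 0 -> x = 0) -> injective f.
Proof.
move=> f0 x y fxy; apply/eqP; rewrite -subr_eq0; apply/eqP/f0.
by rewrite linearB fxy subrr.
Qed.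

Lemma inj_linear0 M N (f : {linear M -> N}) x : injective f -> f x = 0 -> x = 0.
Proof. by move=> f_inj fx0; apply: f_inj; rewrite linear0. Qed.

(** B is an extension of C by A.  Forgetting the maps keeps the dimension
    arguments short, since they never compare two maps. *)
Definition ses A B C : Prop :=
  exists (f : {linear A -> B}) (g : {linear B -> C}), short_exact f g.

Lemma ses_kernel B C (g : {linear B -> C}) : surj g ->
  exists K (k : {linear K -> B}), short_exact k g.
Proof. by have [K [k [k_inj kg]]] := ex_kernel g => g_surj; exists K, k. Qed.

(** A pullback described by its elements: compatible pairs come from [T], and
    [T] embeds in [B * P].  This form is symmetric in [B] and [P]. *)
Definition is_pullback B P C T (b : {linear B -> C}) (p : {linear P -> C})
    (u : {linear T -> B}) (v : {linear T -> P}) : Prop :=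
  [/\ forall t, b (u t) = p (v t),
      forall x y, b x = p y -> exists t, u t = x /\ v t = y
    & forall t, u t = 0 -> v t = 0 -> t = 0].

Lemma ex_pullback B P C (b : {linear B -> C}) (p : {linear P -> C}) :
  exists T (u : {linear T -> B}) (v : {linear T -> P}), is_pullback b p u v.
Proof.
have [d dE] := ex_copair b (\- p : {linear P -> C}).
have {}dE x y : d (x, y) = b x - p y by rewrite dE.
have [T [t [t_inj td]]] := ex_kernel d.
exists T, (fst \o t), (snd \o t); split=> [z|x y bxpy|z /= t1 t2].
- have := exact_at_comp0 z td; rewrite [t z]surjective_pairing dE /=.
  by move/eqP; rewrite subr_eq0 => /eqP.
- have /td[z tz] : d (x, y) = 0 by rewrite dE bxpy subrr.
  by exists z; rewrite /= tz.
- by apply: t_inj; rewrite linear0 [t z]surjective_pairing t1 t2.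
Qed.

Lemma pullback_sym B P C T (b : {linear B -> C}) (p : {linear P -> C})
    (u : {linear T -> B}) (v : {linear T -> P}) :
  is_pullback b p u v -> is_pullback p b v u.
Proof.
case=> [comm ex uniq]; split=> [//|y x pybx|t v0 u0]; last exact: uniq.
by have [t [ut vt]] := ex _ _ (esym pybx); exists t.
Qed.

(** The kernel of a surjection is unchanged by pulling it back. *)
Lemma pullback_ses A B C P T (f : {linear A -> B}) (b : {linear B -> C})
    (p : {linear P -> C}) (u : {linear T -> B}) (v : {linear T -> P}) :
  short_exact f b -> is_pullback b p u v -> ses A T P.
Proof.
case=> f_inj fb b_surj [comm ex uniq].
have [w wE] := ex_pair u v.
have w_inj : injective w.
  by apply: linear_inj => t; rewrite wE => -[]; exact: uniq.
have [h hE] := ex_pair f (\0 : {linear A -> P}).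
have [a|i iE] := ex_lift (h := h) w_inj.
  have [|t [ut vt]] := ex (f a) 0; first by rewrite linear0 exact_at_comp0.
  by exists t; rewrite wE hE ut vt.
have iuv a : u (i a) = f a /\ v (i a) = 0.
  by have := iE a; rewrite wE hE => -[].
exists i, v; split=> [||y].
- apply: linear_inj => a ia0; apply: (inj_linear0 f_inj).
  by rewrite -(iuv a).1 ia0 linear0.
- move=> t; split=> [vt0|[a <-]]; last by rewrite (iuv a).2.
  have /fb[a fa] : b (u t) = 0 by rewrite comm vt0 linear0.
  by exists a; apply: w_inj; rewrite iE hE wE vt0 fa.
- by have [x bx] := b_surj (p y); have [t [_ vt]] := ex _ _ bx; exists t.
Qed.

(** Two presentations of the same [C] compared through their pullback, as in
    Schanuel's lemma. *)
Lemma ses_pullback A B C K P : ses A B C -> ses K P C ->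
  exists T, ses A T P /\ ses K T B.
Proof.
move=> [f [b fb]] [k [p kp]]; have [T [u [v uv]]] := ex_pullback b p.
by exists T; split; [exact: pullback_ses fb uv
                   | exact: pullback_ses kp (pullback_sym uv)].
Qed.

(** The third isomorphism theorem: the preimage [L] of the submodule [A] under
    [p] is the kernel of [g \o p].  The maps are kept because extending a map
    from [K] to [L] and then to [T] needs [K -> L -> T] to be the given [k]. *)
Lemma ses_comp_kernel K T M A C (k : {linear K -> T}) (p : {linear T -> M})
    (f : {linear A -> M}) (g : {linear M -> C}) :
  short_exact k p -> short_exact f g ->
  exists L (l : {linear L -> T}) (i : {linear K -> L}) (q : {linear L -> A}),
    [/\ short_exact l (g \o p), short_exact i q & forall x, l (i x) = k x].
Proof.
case=> k_inj kp p_surj [f_inj fg g_surj].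
have gp_surj : surj (g \o p).
  move=> c; have [m <-] := g_surj c; have [t <-] := p_surj m.
  by exists t.
have [L [l [l_inj lgp _]]] := ses_kernel gp_surj.
have [x|i iE] := ex_lift (h := k) l_inj.
  by apply/lgp; rewrite /= (exact_at_comp0 _ kp) linear0.
have [y|q qE] := ex_lift (h := p \o l) f_inj.
  by apply/fg; exact: (exact_at_comp0 y lgp).
exists L, l, i, q; split=> //; split=> [||a].
- by move=> x y ixy; apply: k_inj; rewrite -!iE ixy.
- move=> y; split=> [qy0|[x <-]].
    have /kp[x kx] : p (l y) = 0 by rewrite -[p _]qE qy0 linear0.
    by exists x; apply: l_inj; rewrite iE.
  by apply: f_inj; rewrite qE /= iE (exact_at_comp0 _ kp) linear0.
- have [t pt] := p_surj (f a).
  have /lgp[y ly] : (g \o p) t = 0 by rewrite /= pt exact_at_comp0.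
  by exists y; apply: f_inj; rewrite qE /= ly.
Qed.

(** The third isomorphism theorem again, now for a chain A < B < P. *)
Lemma ses_comp_cokernel A B C P N :
  ses A B C -> ses B P N -> exists Z, ses A P Z /\ ses C Z N.
Proof.
move=> [f [g [f_inj fg g_surj]]] [j [q [j_inj jq q_surj]]].
have [Z [z [z_surj jfz]]] := ex_cokernel (j \o f).
have [b gb0|i iE] := ex_desc (h := z \o j) g_surj.
  by have /fg[a <-] := gb0; exact: (exact_at_comp0 a jfz).
have [y zy0|r rE] := ex_desc (h := q) z_surj.
  by have /jfz[a <-] := zy0; exact: exact_at_comp0 jq.
exists Z; split; first by exists (j \o f), z; split=> // x y /j_inj/f_inj.
exists i, r; split=> [||n].
- apply: linear_inj => c; have [b <-] := g_surj c; rewrite iE.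
  by move=> /jfz[a /j_inj <-]; exact: exact_at_comp0 fg.
- move=> w; split=> [|[c <-]].
    have [y <-] := z_surj w; rewrite rE => /jq[b <-].
    by exists (g b); rewrite iE.
  by have [b <-] := g_surj c; rewrite iE /= rE exact_at_comp0.
- by have [y <-] := q_surj n; exists (z y); rewrite rE.
Qed.

(** The map [Q -> C] lifts to [B] by projectivity, while [P] reaches [B] through
    [A].  The dimension arguments use this with [P] Gorenstein projective. *)
Lemma horseshoe_kernel A B C A' C' P Q : projective Q ->
  ses A B C -> ses A' P A -> ses C' Q C ->
  exists B', ses B' (P * Q)%type B /\ ses A' B' C'.
Proof.
move=> Q_proj [f [g [f_inj fg g_surj]]] [a' [a [a'_inj a'a a_surj]]].
move=> [c' [c [c'_inj c'c c_surj]]].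
have [s sE] := Q_proj _ _ g c g_surj.
have [t tE] := ex_copair (f \o a) s.
have t_surj : surj t.
  move=> b; have [q cq] := c_surj (g b).
  have /fg[x fx] : g (b - s q) = 0 by rewrite linearB sE cq subrr.
  have [p ap] := a_surj x; exists (p, q).
  by rewrite tE /= ap fx subrK.
have [B' [i it]] := ses_kernel t_surj.
exists B'; split; first by exists i, t.
have [i_inj it0 _] := it.
have gt z : g (t z) = c z.2.
  by case: z => p q; rewrite tE linearD /= exact_at_comp0 // add0r sE.
have [j jE] := ex_pair a' (\0 : {linear A' -> Q}).
have [x|k kE] := ex_lift (h := j) i_inj.
  by apply/it0; rewrite jE tE /= (exact_at_comp0 _ a'a) !linear0 addr0.
have [y|r rE] := ex_lift (h := snd \o i) c'_inj.
  by apply/c'c; rewrite /= -gt (exact_at_comp0 _ it0) linear0.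
exists k, r; split=> [||y].
- move=> x y kxy; apply: a'_inj.
  by have := kE x; rewrite kxy kE !jE => -[].
- move=> y; split=> [ry0|[x <-]]; last first.
    by apply: c'_inj; rewrite rE /= kE jE linear0.
  have iy2 : (i y).2 = 0 by rewrite -[_.2]rE ry0 linear0.
  have := exact_at_comp0 y it0.
  rewrite [i y]surjective_pairing iy2 tE linear0 addr0 /=.
  move=> /(inj_linear0 f_inj)/a'a[x a'x].
  exists x; apply: i_inj.
  by rewrite kE jE a'x [RHS]surjective_pairing iy2.
- have /fg[x fx] : g (s (c' y)) = 0 by rewrite sE exact_at_comp0.
  have [p ap] := a_surj x.
  have /it0[b' ib'] : t (- p, c' y) = 0.
    by rewrite tE /= linearN ap linearN fx addNr.
  by exists b'; apply: c'_inj; rewrite rE /= ib'.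
Qed.

(** Vanishing of Ext^1(M, X), stated without Ext groups: maps to X extend along
    every injection with cokernel M. *)
Definition ext1_zero M X : Prop :=
  forall A B (f : {linear A -> B}) (g : {linear B -> M}), short_exact f g ->
  forall h : {linear A -> X},
  exists k : {linear B -> X}, forall x, k (f x) = h x.

(** The vanishing of Ext^1(C, P) extends [A -> P] to [B]; this replaces the
    injectivity of [P] required by the usual dual horseshoe. *)
Lemma horseshoe_cokernel A B C A1 C1 P Q : ext1_zero C P ->
  ses A B C -> ses A P A1 -> ses C Q C1 ->
  exists B1, ses B (P * Q)%type B1 /\ ses A1 B1 C1.
Proof.
move=> CP [f [g fg_ses]] [a [a1 [a_inj aa1 a1_surj]]].
move=> [c [c1 [c_inj cc1 c1_surj]]].
have [u uE] := CP _ _ _ _ fg_ses a.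
have [f_inj fg g_surj] := fg_ses.
have [t tE] := ex_pair u (c \o g).
have t_inj : injective t.
  apply: linear_inj => b; rewrite tE => -[ub0 /(inj_linear0 c_inj)/fg[x fx]].
  by move: ub0; rewrite -fx uE => /(inj_linear0 a_inj)->; rewrite linear0.
have [B1 [z [z_surj tz]]] := ex_cokernel t.
exists B1; split; first by exists t, z.
have [j jE] := ex_pair (idfun : {linear P -> P}) (\0 : {linear P -> Q}).
have [p a1p0|k kE] := ex_desc (h := z \o j) a1_surj.
  have /aa1[x ax] := a1p0; rewrite /= jE; apply/tz; exists (f x).
  by rewrite tE uE /= ax (exact_at_comp0 _ fg) linear0.
have [y zy0|r rE] := ex_desc (h := c1 \o snd) z_surj.
  by have /tz[b <-] := zy0; rewrite /= tE /= (exact_at_comp0 _ cc1).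
exists k, r; split=> [||y].
- apply: linear_inj => y; have [p <-] := a1_surj y.
  rewrite kE /= jE => /tz[b]; rewrite tE => -[<- /(inj_linear0 c_inj)/fg[x <-]].
  by rewrite uE (exact_at_comp0 _ aa1).
- move=> w; split=> [|[y <-]].
    have [[p q] <-] := z_surj w; rewrite rE => /cc1[y cy].
    have [b gb] := g_surj y.
    (* [(p, q)] is corrected by the image of a preimage [b] of [q], which is zero
       in [B1], to bring it into [P]. *)
    exists (a1 (p - u b)); rewrite kE /= jE.
    have -> : (p, q) = (p - u b, 0) + t b.
      by rewrite tE /= gb cy; congr (_, _); rewrite /= ?subrK ?add0r.
    by rewrite [RHS]linearD (exact_at_comp0 b tz) addr0.
  by have [p <-] := a1_surj y; rewrite kE rE /= jE linear0.
- by have [q <-] := c1_surj y; exists (z (0, q)); rewrite rE.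
Qed.

(** A section of [g] splits the sequence; the last component exhibits [P] as
    the kernel of the retraction [r], so that the sequence can be reversed. *)
Lemma ses_split A B P (f : {linear A -> B}) (g : {linear B -> P}) :
  projective P -> short_exact f g ->
  exists (r : {linear B -> A}) (s : {linear P -> B}),
    [/\ forall x, r (f x) = x, forall y, g (s y) = y & short_exact s r].
Proof.
move=> P_proj [f_inj fg g_surj].
have [s sE] := P_proj _ _ g idfun g_surj.
have [b|r rE] := ex_lift (h := idfun \- (s \o g) : {linear B -> B}) f_inj.
  by apply/fg; rewrite /= linearB sE subrr.
have rf x : r (f x) = x.
  by apply: f_inj; rewrite rE /= (exact_at_comp0 _ fg) linear0 subr0.
exists r, s; split=> //; split=> [||x]; last by exists (f x).
- by move=> x y /(congr1 g); rewrite !sE.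
- move=> b; split=> [rb0|[y <-]]; last first.
    by apply: f_inj; rewrite rE /= sE subrr linear0.
  exists (g b); apply/eqP; rewrite eq_sym -subr_eq0.
  rewrite -[_ - _]/((idfun \- (s \o g)) b).
  by rewrite -rE rb0 linear0.
Qed.

Lemma ext1_zero_projective P X : projective P -> ext1_zero P X.
Proof.
move=> P_proj A B f g fg h; have [r [s [rf _ _]]] := ses_split P_proj fg.
by exists (h \o r) => x /=; rewrite rf.
Qed.

(** Given 0 -> K -> T -> B -> 0, a map on [K] extends first to the preimage of
    [A] in [T] (with quotient [A]) and then to [T] (with quotient [C]). *)
Lemma ext1_zero_extension A B C X :
  ses A B C -> ext1_zero A X -> ext1_zero C X -> ext1_zero B X.
Proof.
move=> [f [g fg]] AX CX K T k p kp h.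
have [L [l [i [q [lgp iq li]]]]] := ses_comp_kernel kp fg.
have [h1 h1E] := AX _ _ _ _ iq h; have [h2 h2E] := CX _ _ _ _ lgp h1.
by exists h2 => x; rewrite -li h2E h1E.
Qed.

(** An extension [T] of [A] becomes the extension [T * P] of [B = A (+) P] with
    the same kernel; restrict the extended map to [T]. *)
Lemma ext1_zero_summand A B P X :
  projective P -> ses A B P -> ext1_zero B X -> ext1_zero A X.
Proof.
move=> P_proj [f [g fg]] BX K T k p [k_inj kp p_surj] h.
have [r [s [_ gs [s_inj sr r_surj]]]] := ses_split P_proj fg.
have [f_inj fg0 g_surj] := fg.
have [t tE] := ex_copair (f \o p) s.
have [j jE] := ex_pair k (\0 : {linear K -> P}).
have jt : short_exact j t.
  split=> [x y|[y z]|b]; first by rewrite !jE => -[/k_inj].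
    rewrite tE /=; split=> [fs0|[x]]; last first.
      by rewrite jE => -[<- <-]; rewrite (exact_at_comp0 _ kp) !linear0 addr0.
    have z0 : z = 0.
      by have := congr1 g fs0; rewrite linearD gs exact_at_comp0 // linear0 add0r.
    move: fs0; rewrite z0 linear0 addr0 => /(inj_linear0 f_inj)/kp[x kx].
    by exists x; rewrite jE kx.
  have /fg0[a fa] : g (b - s (g b)) = 0 by rewrite linearB gs subrr.
  have [y py] := p_surj a; exists (y, g b).
  by rewrite tE /= py fa subrK.
have [h' h'E] := BX _ _ _ _ jt h.
have [i iE] := ex_pair (idfun : {linear T -> T}) (\0 : {linear T -> P}).
by exists (h' \o i) => x; rewrite /= iE -h'E jE.
Qed.

(** Ext^1 may be computed from one projective presentation: any other extension
    [T] of [M] by [A] is the pushout of [P] along a map [K -> A]. *)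
Lemma ext1_zero_presentation K P M X
    (k : {linear K -> P}) (p : {linear P -> M}) :
  projective P -> short_exact k p ->
  (forall h : {linear K -> X},
     exists e : {linear P -> X}, forall x, e (k x) = h x) ->
  ext1_zero M X.
Proof.
move=> P_proj [k_inj kp p_surj] KX A T i q [i_inj iq q_surj] h.
have [s sE] := P_proj _ _ q p q_surj.
have [x|d dE] := ex_lift (h := s \o k) i_inj.
  by apply/iq; rewrite /= sE exact_at_comp0.
have [e eE] := KX (h \o d).
(* [T] is the quotient of [A * P] by the antidiagonal copy of [K], on which
   [h + e] vanishes. *)
have [t tE] := ex_copair i s; have [v vE] := ex_copair h e.
have t_surj : surj t.
  move=> y; have [x px] := p_surj (q y).
  have /iq[a ia] : q (y - s x) = 0 by rewrite linearB sE px subrr.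
  by exists (a, x); rewrite tE ia subrK.
have [[a x] tax0|w wE] := ex_desc (h := v) t_surj.
  move: tax0; rewrite tE vE => iasx.
  have /kp[y ky] : p x = 0.
    by rewrite -sE -[RHS](linear0 q) -iasx linearD (exact_at_comp0 a iq) add0r.
  have -> : a = - d y.
    apply: i_inj; apply/eqP; rewrite linearN -addr_eq0 dE /= ky.
    exact/eqP.
  by rewrite -ky eE linearN addNr.
by exists w => a; have := wE (a, 0); rewrite tE vE !linear0 !addr0.
Qed.

End Sequences.

(** * Complete classes and the class of Gorenstein projectives *)

Section GorensteinProjective.
Variables (R : nzRingType) (XX : lmodType R -> Prop).
Hypothesis XX_proj : forall P : lmodType R, projective P -> XX P.
Implicit Types A B C G K M N P Q : lmodType R.
Implicit Types W V : lmodType R -> Prop.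

(** One step of a complete resolution through the cycle [M]; [V] is the class
    required of the two neighbouring cycles. *)
Definition extendable V M : Prop :=
  [/\ forall X, XX X -> ext1_zero M X,
      exists K P, [/\ projective P, V K & ses K P M]
    & exists P N, [/\ projective P, V N & ses M P N]].

Definition complete_class W : Prop := forall M, W M -> extendable W M.

(** The greatest complete class.  It characterizes the [XX]-Gorenstein
    projectives by single short exact sequences; see [Xgproj_gproj] and
    [gproj_Xgproj]. *)
Definition gproj M : Prop := exists W, complete_class W /\ W M.

Lemma extendable_mono V W M :
  (forall N, V N -> W N) -> extendable V M -> extendable W M.
Proof.
move=> VW [ext [K [P [P_proj /VW WK s]]] [Q [N [Q_proj /VW WN s']]]].
by split=> //; [exists K, P | exists Q, N].
Qed.

Lemma gproj_extendable M : gproj M -> extendable gproj M.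
Proof.
move=> [W [W_complete WM]]; apply: extendable_mono (W_complete _ WM) => N WN.
by exists W.
Qed.

(** Coinduction up to [gproj]: neighbouring cycles already known to be Gorenstein
    projective are allowed to leave the class under construction. *)
Lemma gproj_coind W :
  (forall M, W M -> extendable (fun N => W N \/ gproj N) M) ->
  forall M, W M -> gproj M.
Proof.
move=> Wext M WM; exists (fun N => W N \/ gproj N); split; last by left.
move=> N [/Wext//|/gproj_extendable]; apply: extendable_mono => L; by right.
Qed.

Definition trivial_module M : Prop := forall x : M, x = 0.

Lemma trivial_projective M : trivial_module M -> projective M.
Proof.
move=> M0 L N p h _; exists \0 => x.
by rewrite (M0 x) /= !linear0.
Qed.

Lemma trivial_ses A B C (f : {linear A -> B}) (g : {linear B -> C}) :
  trivial_module A -> injective g -> surj g -> short_exact f g.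
Proof.
move=> A0 g_inj g_surj; split=> // [x y _|y]; first by rewrite (A0 x) (A0 y).
split=> [/(inj_linear0 g_inj)->|[x <-]]; first by exists 0; rewrite linear0.
by rewrite (A0 x) !linear0.
Qed.

Lemma ex_trivial : exists M, trivial_module M.
Proof.
have [K [k [k_inj kid]]] := ex_kernel (idfun : {linear R^o -> R^o}).
by exists K => x; apply: (inj_linear0 k_inj); exact: (exact_at_comp0 x kid).
Qed.

(** A projective [P] is a cycle of the complex that has [P -> P] in two adjacent
    degrees and zero elsewhere. *)
Lemma projective_gproj P : projective P -> gproj P.
Proof.
apply: gproj_coind P => P P_proj.
have [Z Z0] := ex_trivial; have Z_proj := trivial_projective Z0.
split=> [X _||]; first exact: ext1_zero_projective.
  exists Z, P; split; [by []|by left|].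
  by exists \0, idfun; apply: trivial_ses => // x; exists x.
exists P, Z; split; [by []|by left|]; exists idfun, \0; split=> // y.
  by split=> // _; exists y.
by exists 0; rewrite linear0 (Z0 y).
Qed.

Lemma projective_prod P Q :
  projective P -> projective Q -> projective (P * Q)%type.
Proof.
move=> P_proj Q_proj M N p h p_surj.
have [i iE] := ex_pair (idfun : {linear P -> P}) (\0 : {linear P -> Q}).
have [j jE] := ex_pair (\0 : {linear Q -> P}) (idfun : {linear Q -> Q}).
have [k kE] := P_proj _ _ p (h \o i) p_surj.
have [l lE] := Q_proj _ _ p (h \o j) p_surj.
have [m mE] := ex_copair k l; exists m => -[x y].
rewrite mE linearD kE lE /= -linearD iE jE.
by congr (h (_, _)); rewrite /= ?addr0 ?add0r.
Qed.

Lemma ses_prod A B : ses A (A * B)%type B.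
Proof.
have [i iE] := ex_pair (idfun : {linear A -> A}) (\0 : {linear A -> B}).
exists i, snd; split=> [x y|[x y] /=|y]; last by exists (0, y).
  by rewrite !iE => -[].
split=> [->|[z]]; first by exists x; rewrite iE.
by rewrite iE => -[].
Qed.

Lemma ses_comp A B C K T : ses K T B -> ses A B C ->
  exists L, ses L T C /\ ses K L A.
Proof.
move=> [k [p kp]] [f [g fg]].
have [L [l [i [q [lgp iq _]]]]] := ses_comp_kernel kp fg.
by exists L; split; [exists l, (g \o p) | exists i, q].
Qed.

(** Both horseshoes leave an extension of Gorenstein projectives behind, so the
    class of all such extensions is complete. *)
Lemma gproj_extension A B C : ses A B C -> gproj A -> gproj C -> gproj B.
Proof.
move=> ABC gA gC.
pose W M := exists A C, [/\ gproj A, gproj C & ses A M C].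
apply: (@gproj_coind W); last by exists A, C.
move=> {A B C ABC gA gC} B [A [C [gA gC ABC]]].
have [extA [A' [P [P_proj gA' sA]]] [P1 [A1 [P1_proj gA1 sA1]]]] :=
  gproj_extendable gA.
have [extC [C' [Q [Q_proj gC' sC]]] [Q1 [C1 [Q1_proj gC1 sC1]]]] :=
  gproj_extendable gC.
split=> [X XX_X||].
- exact: ext1_zero_extension ABC (extA _ XX_X) (extC _ XX_X).
- have [B' [sB s']] := horseshoe_kernel Q_proj ABC sA sC.
  exists B', (P * Q)%type; split=> //; first exact: projective_prod.
  by left; exists A', C'.
- have CP1 := extC _ (XX_proj P1_proj).
  have [B1 [sB s']] := horseshoe_cokernel CP1 ABC sA1 sC1.
  exists (P1 * Q1)%type, B1; split=> //; first exact: projective_prod.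
  by left; exists A1, C1.
Qed.

(** Here [B = A (+) P].  Composing an epimorphism from a projective to [B]
    with the retraction onto [A] enlarges its kernel by [P]; composing [A -> B] with an embedding of
    [B] in a projective enlarges the cokernel by [P].  Both stay Gorenstein
    projective by closure under extensions. *)
Lemma gproj_summand A B P : ses A B P -> gproj B -> projective P -> gproj A.
Proof.
move=> ABP gB P_proj.
pose W M := exists B P, [/\ gproj B, projective P & ses M B P].
apply: (@gproj_coind W); last by exists B, P.
move=> {A B P ABP gB P_proj} A [B [P [gB P_proj ABP]]].
have [extB [B' [Q [Q_proj gB' sB]]] [Q1 [B1 [Q1_proj gB1 sB1]]]] :=
  gproj_extendable gB.
have gP := projective_gproj P_proj.
split=> [X XX_X||].
- exact: ext1_zero_summand P_proj ABP (extB _ XX_X).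
- have PBA : ses P B A.
    have [f [g fg]] := ABP; have [r [s [_ _ sr]]] := ses_split P_proj fg.
    by exists s, r.
  have [L [sL sL']] := ses_comp sB PBA.
  exists L, Q; split=> //; right; exact: gproj_extension sL' gB' gP.
- have [Z [sZ sZ']] := ses_comp_cokernel ABP sB1.
  exists Q1, Z; split=> //; right; exact: gproj_extension sZ' gP gB1.
Qed.

(** Pulling back along an epimorphism from a projective to [C] reduces to a
    projective quotient. *)
Lemma gproj_kernel A B C : ses A B C -> gproj B -> gproj C -> gproj A.
Proof.
move=> ABC gB gC.
have [_ [C' [P [P_proj gC' sC]]] _] := gproj_extendable gC.
have [T [sT sT']] := ses_pullback ABC sC.
exact: gproj_summand sT (gproj_extension sT' gC' gB) P_proj.
Qed.

(** * Modules of finite Gorenstein projective dimension *)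

(** Finite dimension without its value: the proofs induct on a resolution read
    from left to right, and no bound has to be tracked. *)
Inductive finite_gdim : lmodType R -> Prop :=
| finite_gdim_gproj M : gproj M -> finite_gdim M
| finite_gdim_step K G M :
    gproj G -> finite_gdim K -> ses K G M -> finite_gdim M.

(** Induction on [A]: the horseshoe trades [A] for its syzygy [K] and [C] for a
    syzygy that is again Gorenstein projective. *)
Lemma finite_gdim_extension_gproj A B C :
  ses A B C -> finite_gdim A -> gproj C -> finite_gdim B.
Proof.
move=> + dA; elim: dA B C => {A} [A gA B C ABC gC|K G A gG _ IH sA B C ABC gC].
  by apply: finite_gdim_gproj; exact: gproj_extension ABC gA gC.
have [_ [C' [P [P_proj gC' sC]]] _] := gproj_extendable gC.
have [B' [sB s']] := horseshoe_kernel P_proj ABC sA sC.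
apply: finite_gdim_step sB; last exact: IH s' gC'.
exact: gproj_extension (ses_prod G P) gG (projective_gproj P_proj).
Qed.

(** The reduction of quotients to extensions, with closure under extensions
    assumed only for the given submodule [A]: this form serves both inside the
    induction that proves closure under extensions and after it. *)
Lemma finite_gdim_quotient_of A B C :
  (forall K L, ses K L A -> finite_gdim K -> finite_gdim L) ->
  ses A B C -> finite_gdim A -> finite_gdim B -> finite_gdim C.
Proof.
move=> extA ABC dA dB; case: dB ABC => [{}B gB|K G {}B gG dK sB] ABC.
  exact: finite_gdim_step gB dA ABC.
have [L [sL sL']] := ses_comp sB ABC.
exact: finite_gdim_step gG (extA _ _ sL' dK) sL.
Qed.

(** Induction on [C = G / K]: the pullback [T] has [G] in place of [C], and
    returning from [T] to [B = T / K] only involves extensions of [K], which the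
    induction hypothesis covers. *)
Lemma finite_gdim_extension A B C :
  ses A B C -> finite_gdim A -> finite_gdim C -> finite_gdim B.
Proof.
move=> + + dC.
elim: dC A B => {C} [C gC A B ABC dA|K G C gG dK IH sC A B ABC dA].
  exact: finite_gdim_extension_gproj ABC dA gC.
have [T [sT sT']] := ses_pullback ABC sC.
have dT := finite_gdim_extension_gproj sT dA gG.
by apply: finite_gdim_quotient_of sT' dK dT => K' L; exact: IH.
Qed.

Lemma finite_gdim_quotient A B C :
  ses A B C -> finite_gdim A -> finite_gdim B -> finite_gdim C.
Proof.
move=> ABC dA; apply: (finite_gdim_quotient_of _ ABC dA) => K L KLA dK.
exact: finite_gdim_extension KLA dK dA.
Qed.

Lemma finite_gdim_kernel_gproj A B C :
  ses A B C -> finite_gdim B -> gproj C -> finite_gdim A.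
Proof.
move=> ABC dB gC; case: dB ABC => [{}B gB|K G {}B gG dK sB] ABC.
  by apply: finite_gdim_gproj; exact: gproj_kernel ABC gB gC.
have [L [sL sL']] := ses_comp sB ABC.
exact: finite_gdim_step (gproj_kernel sL gG gC) dK sL'.
Qed.

(** The pullback to [G] replaces [C] by a Gorenstein projective quotient. *)
Lemma finite_gdim_kernel A B C :
  ses A B C -> finite_gdim B -> finite_gdim C -> finite_gdim A.
Proof.
move=> ABC dB dC; case: dC ABC => [{}C gC|K G {}C gG dK sC] ABC.
  exact: finite_gdim_kernel_gproj ABC dB gC.
have [T [sT sT']] := ses_pullback ABC sC.
apply: finite_gdim_kernel_gproj sT _ gG.
exact: finite_gdim_extension sT' dK dB.
Qed.

End GorensteinProjective.

(** * Cycles of complete resolutions *)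

(** The four kinds of spots of a [biseq] as one relation.  A spot has a
    predecessor and a successor, so arguments about cycles need no case
    distinction on where the two halves of the sequence meet. *)
Inductive consecutive (R : nzRingType) (P : biseq R) :
    forall L M N : lmodType R, {linear L -> M} -> {linear M -> N} -> Prop :=
| consecutive_lod n : consecutive P (lod P n.+1) (lod P n)
| consecutive_lod_midd : consecutive P (lod P 0) (midd P)
| consecutive_midd_upd : consecutive P (midd P) (upd P 0)
| consecutive_upd n : consecutive P (upd P n) (upd P n.+1).

Section Cycles.
Variables (R : nzRingType) (XX : lmodType R -> Prop) (P : biseq R).

Lemma consecutive_before (L M N : lmodType R)
    (f : {linear L -> M}) (g : {linear M -> N}) :
  consecutive P f g ->
  exists (K : lmodType R) (e : {linear K -> L}), consecutive P e f.
Proof.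
case=> [n|||[|n]].
- by exists _, (lod P n.+2); constructor.
- by exists _, (lod P 1); constructor.
- by exists _, (lod P 0); constructor.
- by exists _, (midd P); constructor.
- by exists _, (upd P n); constructor.
Qed.

Lemma consecutive_after (L M N : lmodType R)
    (f : {linear L -> M}) (g : {linear M -> N}) :
  consecutive P f g ->
  exists (K : lmodType R) (h : {linear N -> K}), consecutive P g h.
Proof.
case=> [[|n]|||n].
- by exists _, (midd P); constructor.
- by exists _, (lod P n); constructor.
- by exists _, (upd P 0); constructor.
- by exists _, (upd P 1); constructor.
- by exists _, (upd P n.+2); constructor.
Qed.

Lemma consecutive_spot (E : forall L M N : lmodType R,
      {linear L -> M} -> {linear M -> N} -> Prop)
    (L M N : lmodType R) (f : {linear L -> M}) (g : {linear M -> N}) :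
  biseq_all_spots E P -> consecutive P f g -> E L M N f g.
Proof. by case=> Elo Em Em' Eup; case. Qed.

Lemma consecutive_term (Q : lmodType R -> Prop)
    (L M N : lmodType R) (f : {linear L -> M}) (g : {linear M -> N}) :
  biseq_all_terms Q P -> consecutive P f g -> Q L /\ Q M.
Proof.
move=> PQ; case=> [n|||n]; split; by [apply (PQ _).1 | apply (PQ _).2].
Qed.

Definition cycle_module (Z : lmodType R) : Prop :=
  exists (L M N : lmodType R) (f : {linear L -> M}) (g : {linear M -> N}),
    consecutive P f g /\
    exists i : {linear Z -> M}, injective i /\ exact_at i g.

Hypothesis P_proj : biseq_all_terms (@projective R) P.
Hypothesis P_exact : biseq_all_spots (@exact_at R) P.
Hypothesis P_hom : forall X, XX X -> biseq_all_spots (@hom_exact_at R X) P.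

(** Exactness makes a cycle an extension of the next one.  Exactness after
    Hom(-, X), used one spot to the left of the presentation 0 -> Y -> L -> Z -> 0,
    says that maps Y -> X extend to the projective L, hence Ext^1(Z, X) = 0. *)
Lemma cycle_complete : complete_class XX cycle_module.
Proof.
move=> Z [L [M [N [f [g [fg [i [i_inj ig]]]]]]]].
have [K [e ef]] := consecutive_before fg.
have [J [d de]] := consecutive_before ef.
have [L_proj M_proj] := consecutive_term P_proj fg.
have ex_fg := consecutive_spot P_exact fg.
have ex_ef := consecutive_spot P_exact ef.
have ex_de := consecutive_spot P_exact de.
have [Y [k [k_inj kf]]] := ex_kernel f.
have [x|p pE] := ex_lift (h := f) i_inj.
  by apply/ig; exact: exact_at_comp0.
have kp : short_exact k p.
  split=> // [y|z].
    by rewrite -(kf y) -pE; split=> [->|/(inj_linear0 i_inj)//]; rewrite linear0.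
  have /ex_fg[x fx] : g (i z) = 0 by exact: exact_at_comp0.
  by exists x; apply: i_inj; rewrite pE.
split=> [X XX_X||].
- apply: ext1_zero_presentation L_proj kp _ => h.
  have [x|q qE] := ex_lift (h := e) k_inj.
    by apply/kf; exact: exact_at_comp0.
  (* A map [h] on [Y = im e] is seen by Hom(-, X) as [h \o q] on [K], which
     vanishes on the image of [d]. *)
  have [+ _] := consecutive_spot (P_hom XX_X) de (h \o q).
  case=> [x|m mE].
    rewrite /= -[RHS](linear0 h); congr (h _); apply: k_inj.
    by rewrite qE linear0 exact_at_comp0.
  exists m => y; have /ex_ef[x ex] : f (k y) = 0 by exact: exact_at_comp0.
  have -> : y = q x by apply: k_inj; rewrite qE.
  by rewrite qE mE.
- exists Y, L; split=> //; last by exists k, p.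
  by exists K, L, M, e, f; split=> //; exists k.
- have [O [h gh]] := consecutive_after fg.
  have ex_gh := consecutive_spot P_exact gh.
  have [B [j [j_inj jh]]] := ex_kernel h.
  have [y|q qE] := ex_lift (h := g) j_inj.
    by apply/jh; exact: exact_at_comp0.
  exists M, B; split=> //; first by exists M, N, O, g, h; split=> //; exists j.
  exists i, q; split=> // [y|z].
    by rewrite -(ig y) -qE; split=> [->|/(inj_linear0 j_inj)//]; rewrite linear0.
  have /ex_gh[y gy] : h (j z) = 0 by exact: exact_at_comp0.
  by exists y; apply: j_inj; rewrite qE.
Qed.

End Cycles.

Lemma Xgproj_gproj (R : nzRingType) (XX : lmodType R -> Prop) (G : lmodType R) :
  Xgproj XX G -> gproj XX G.
Proof.
move=> [P [P_proj P_exact P_hom [i [i_inj im]]]].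
exists (cycle_module P); split; first exact: cycle_complete.
by exists _, _, _, (lod P 0), (midd P); split; [constructor | exists i].
Qed.

(** * Complete resolutions from short exact sequences *)

Section Gluing.
Variable R : nzRingType.
Implicit Types K M N O X : lmodType R.

(** The piece of a complete resolution between two adjacent cycles. *)
Record tile K M := Tile {
  tile_mid : lmodType R;
  tile_in : {linear K -> tile_mid};
  tile_out : {linear tile_mid -> M};
  tile_exact : short_exact tile_in tile_out;
  tile_proj : projective tile_mid
}.

Definition glue K M N (s : tile K M) (t : tile M N) :
    {linear tile_mid s -> tile_mid t} :=
  tile_in t \o tile_out s.

Lemma glue_exact K M N O (s : tile K M) (t : tile M N) (u : tile N O) :
  exact_at (glue s t) (glue t u).
Proof.
have [_ _ s_surj] := tile_exact s; have [_ t_ex _] := tile_exact t.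
have [u_inj _ _] := tile_exact u; move=> y; split=> /=.
  move=> /(inj_linear0 u_inj)/t_ex[m <-].
  by have [x <-] := s_surj m; exists x.
by move=> [x <-]; rewrite (exact_at_comp0 _ t_ex) linear0.
Qed.

(** A map that vanishes on the image of [glue s t] descends to the cycle [N],
    which embeds in [tile_mid u] with cokernel [O]. *)
Lemma glue_hom_exact K M N O X (s : tile K M) (t : tile M N) (u : tile N O) :
  ext1_zero O X -> hom_exact_at X (glue s t) (glue t u).
Proof.
move=> OX h; split=> [h0|[k kE] x]; last first.
  by rewrite -kE (exact_at_comp0 _ (@glue_exact _ _ _ _ s t u)) linear0.
have [_ _ s_surj] := tile_exact s; have [_ t_ex t_surj] := tile_exact t.
have [y ty0|k kE] := ex_desc (h := h) t_surj.
  have /t_ex[m <-] := ty0; have [x <-] := s_surj m; exact: h0.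
have [l lE] := OX _ _ _ _ (tile_exact u) k.
by exists l => y; rewrite /= lE kE.
Qed.

End Gluing.

(** Tiles are laid to the left and to the right of [G] by iterated choice and
    glued. *)
Lemma gproj_Xgproj (R : nzRingType) (XX : lmodType R -> Prop) (G : lmodType R) :
  gproj XX G -> Xgproj XX G.
Proof.
move=> gG; pose cyc := {M : lmodType R | gproj XX M}.
have ext (m : cyc) X : XX X -> ext1_zero (sval m) X.
  by case: m => M /= /gproj_extendable[+ _ _]; apply.
have before (m : cyc) : {k : cyc & tile (sval k) (sval m)}.
  apply: inhabited_witness; case: m => M /= gM.
  have [_ [K [P [P_proj gK [k [p kp]]]]] _] := gproj_extendable gM.
  by split; exists (exist _ K gK); exact: Tile kp P_proj.
have after (m : cyc) : {n : cyc & tile (sval m) (sval n)}.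
  apply: inhabited_witness; case: m => M /= gM.
  have [_ _ [P [N [P_proj gN [k [p kp]]]]]] := gproj_extendable gM.
  by split; exists (exist _ N gN); exact: Tile kp P_proj.
(* The first tile has [G] on its left, so its middle term is P_0 and the kernel
   of P_0 -> P^0 is [G].  A state of the leftward iteration carries both ends of
   its tile: the right end of each tile is then convertible to the left end of
   the tile laid before it, and the two can be glued without a transport. *)
pose c0 : cyc := exist _ G gG.
pose low_state := {km : cyc * cyc & tile (sval km.1) (sval km.2)}.
pose low n : low_state := iter n (fun s : low_state =>
    existT _ (projT1 (before (tag s).1), (tag s).1) (projT2 (before (tag s).1)))
  (existT _ (c0, projT1 (after c0)) (projT2 (after c0))).
pose upc n : cyc := iter n (fun m => projT1 (after m)) (tag (low 0)).2.
pose lt n : tile (sval (tag (low n)).1) (sval (tag (low n)).2) := tagged (low n).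
pose ut n : tile (sval (upc n)) (sval (upc n.+1)) := projT2 (after (upc n)).
pose P : biseq R := @BiSeq R
  (fun n => tile_mid (lt n)) (fun n => tile_mid (ut n))
  (fun n => glue (lt n.+1 : tile _ (sval (tag (low n)).1)) (lt n))
  (glue (lt 0 : tile _ (sval (upc 0))) (ut 0))
  (fun n => glue (ut n) (ut n.+1)).
exists P; split.
- by move=> n; split; exact: tile_proj.
- by split=> [n|||n]; exact: glue_exact.
- move=> X XX_X; split=> [n|||n]; apply: glue_hom_exact; exact: ext.
- have [i_inj i_ex _] := tile_exact (lt 0).
  have [u_inj _ _] := tile_exact (ut 0).
  exists (tile_in (lt 0)); split=> // y /=; rewrite -(i_ex y).
  by split=> [/(inj_linear0 u_inj)|->] //; rewrite linear0.
Qed.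

(** * Finite resolutions *)

Section Resolutions.
Variables (R : nzRingType) (XX : lmodType R -> Prop).

(** The kernel of the augmentation inherits the shifted resolution; for a
    resolution of length 0 it is a quotient of the zero module [G 1]. *)
Lemma resolution_syzygy n (M : lmodType R) : has_Xgproj_resolution XX M n ->
  exists K G : lmodType R, [/\ gproj XX G, ses K G M
    & if n is m.+1 then has_Xgproj_resolution XX K m else trivial_module K].
Proof.
move=> [G [d [e [gG G0 e_surj de dd]]]].
have [K [k ke]] := ses_kernel e_surj; have [k_inj ke0 _] := ke.
have [x|c cE] := ex_lift (h := d 0) k_inj.
  by apply/ke0; exact: exact_at_comp0.
have c_surj : surj c.
  move=> y; have /de[x dx] : e (k y) = 0 by exact: exact_at_comp0.
  by exists x; apply: k_inj; rewrite cE.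
exists K, (G 0); split; [exact/Xgproj_gproj/gG|by exists k, e|].
case: n gG G0 => [|n] gG G0.
  by move=> y; have [x <-] := c_surj y; rewrite (G0 1 isT x) linear0.
exists (fun i => G i.+1), (fun i => d i.+1), c; split=> //.
- by move=> i lein; exact: gG.
- by move=> i ltni; exact: G0.
- move=> y; rewrite -(dd 0 y) -cE.
  by split=> [->|/(inj_linear0 k_inj)//]; rewrite linear0.
Qed.

Lemma resolution_finite_gdim n (M : lmodType R) :
  has_Xgproj_resolution XX M n -> finite_gdim XX M.
Proof.
elim: n M => [|n IH] M /resolution_syzygy[K [G [gG sM resK]]].
  apply: finite_gdim_step gG _ sM.
  exact/finite_gdim_gproj/projective_gproj/trivial_projective.
exact: finite_gdim_step gG (IH _ resK) sM.
Qed.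

Lemma finite_gdim_resolution (M : lmodType R) :
  finite_gdim XX M -> exists n, has_Xgproj_resolution XX M n.
Proof.
elim=> {M} [M gM|K G M gG _ resK [k [p [k_inj kp p_surj]]]].
  have [Z Z0] := ex_trivial R.
  (* The resolution 0 -> M -> M -> 0. *)
  exists 0, (fun i => if i is 0 then M else Z), (fun i => \0), idfun; split.
  - by case=> // _; exact: gproj_Xgproj.
  - by case.
  - by move=> y; exists y.
  - by move=> y /=; split=> [->|[x <-]] //; exists 0.
  - by move=> i y; rewrite (Z0 y); split=> // _; exists 0.
have [n [H [d [e [gH H0 e_surj de dd]]]]] := resK.
pose G1 i : lmodType R := if i is j.+1 then H j else G.
pose d1 i : {linear G1 i.+1 -> G1 i} :=
  match i return {linear G1 i.+1 -> G1 i} with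
  | 0 => k \o e
  | j.+1 => d j
  end.
exists n.+1, G1, d1, p; split=> //.
- by case=> [_|i lein]; [exact: gproj_Xgproj | exact: gH].
- by case=> // i; exact: H0.
- move=> y; rewrite (kp y) /=; split=> [[z <-]|[x <-]]; last by exists (e x).
  by have [x <-] := e_surj z; exists x.
- case=> [y|i]; last exact: dd.
  by rewrite -(de y) /=; split=> [/(inj_linear0 k_inj)|->] //; rewrite linear0.
Qed.

Lemma Xgpd_lty (M : lmodType R) : (Xgpd XX M < +oo)%E <-> finite_gdim XX M.
Proof.
rewrite /Xgpd; case: pselect => [ex_n|no_n].
  split=> _; last exact: ltry.
  by have [n /asboolP] := ex_n; exact: resolution_finite_gdim.
split=> [|/finite_gdim_resolution[n Mn]]; first by rewrite ltxx.
by case: no_n; exists n; apply/asboolP.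
Qed.

End Resolutions.

Theorem theorem3p6 (R : nzRingType) (XX : lmodType R -> Prop)
    (XX_proj : forall P : lmodType R, projective P -> XX P)
    (A B C : lmodType R) (f : {linear A -> B}) (g : {linear B -> C})
    (fg_exact : short_exact f g) :
  [/\ (Xgpd XX A < +oo)%E -> (Xgpd XX C < +oo)%E -> (Xgpd XX B < +oo)%E,
      (Xgpd XX A < +oo)%E -> (Xgpd XX B < +oo)%E -> (Xgpd XX C < +oo)%E
    & (Xgpd XX B < +oo)%E -> (Xgpd XX C < +oo)%E -> (Xgpd XX A < +oo)%E].
Proof.
have ABC : ses A B C by exists f, g.
split=> /Xgpd_lty d1 /Xgpd_lty d2; apply/Xgpd_lty.
- exact: finite_gdim_extension ABC d1 d2.
- exact: finite_gdim_quotient ABC d1 d2.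
- exact: finite_gdim_kernel ABC d1 d2.
Qed.
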